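(* Let $\varphi$ be an Orlicz integrand. If $L_\varphi(\mu)$ is separable and $\mu$ has no atom of infinite measure, then $L_\varphi(\mu)=C_\varphi(\mu)$. Likewise, for an arbitrary measure $\mu$, if $L^\sigma_\varphi(\mu)$ is separable then $L^\sigma_\varphi(\mu)=C^\sigma_\varphi(\mu)$.
   Context: $(\Omega,\mathcal{A},\mu)$ measure space with nontrivial positive measure, $X$ real Banach space. Orlicz integrand: $\varphi\colon\Omega\times X\to[0,\infty]$ with $\varphi(\omega,\cdot)$ even, convex, lsc, proper, $\varphi(\omega,x)\to0$ as $x\to0$, $\varphi(\omega,x)\to\infty$ as $\|x\|\to\infty$ for a.e. $\omega$, and restriction to $A\times W$ being $\mathcal{A}(A)\otimes\mathcal{B}(W)$-measurable for every set $A$ that is a union of countably many atoms and a $\sigma$-finite set and every separable $W\subset X$. $L_\varphi(\mu)$: a.e.-classes of strongly measurable $u$ with finite Luxemburg norm $\|u\|_\varphi=\inf\{\alpha>0:\int\varphi(\omega,u/\alpha)d\mu\le1\}$; $L^\sigma_\varphi(\mu)$ its elements vanishing outside a $\sigma$-finite set. $C_\varphi(\mu)$: $u\in L_\varphi(\mu)$ with $\|u\chi_{E_n}\|_\varphi\to0$ for every $E_n\in\mathcal{A}$ with $\chi_{E_n}\to0$ a.e.; $C^\sigma_\varphi(\mu)=C_\varphi(\mu)\cap L^\sigma_\varphi(\mu)$. *)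

(* Defs.v *)
From HB Require Import structures.
From mathcomp Require Import all_boot all_order all_algebra.
From mathcomp Require Import all_classical all_reals all_analysis measurable_realfun.
Set Implicit Arguments. Unset Strict Implicit. Unset Printing Implicit Defensive.
Import Order.TTheory GRing.Theory Num.Theory.
Import numFieldNormedType.Exports.
Local Open Scope classical_set_scope.
Local Open Scope ring_scope.

Section OrliczDefs.
Context {d : measure_display} {T : measurableType d} {R : realType}
  (mu : {measure set T -> \bar R}) {X : completeNormedModType R}.

Definition atom (A : set T) : Prop :=
  [/\ measurable A, (0 < mu A)%E &
      forall B, measurable B -> B `<=` A -> mu B = 0%E \/ mu (A `\` B) = 0%E].

Definition sigma_finite_set (S : set T) : Prop :=
  exists F : nat -> set T, (forall n, measurable (F n) /\ (mu (F n) < +oo)%E) /\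
    S = \bigcup_n F n.

Definition atoms_sfinite_union (A : set T) : Prop :=
  exists (Fa : set (set T)) (S : set T), [/\ countable Fa, Fa `<=` atom,
    sigma_finite_set S & A = (\bigcup_(a in Fa) a) `|` S].

Definition separable_subset (W : set X) : Prop :=
  exists D : set X, [/\ countable D, D `<=` W & W `<=` closure D].

Definition borelX : set (set X) := <<s [set O : set X | open O] >>.

Definition prod_sigma : set (set (T * X)) :=
  <<s [set M `*` B | M in [set M : set T | measurable M] & B in borelX] >>.

(* restriction of f to A * W is A(A) (x) B(W)-measurable (trace sigma-algebras) *)
Definition trace_measurable (f : T * X -> \bar R) (A : set T) (W : set X) : Prop :=
  forall E : set (\bar R), measurable E ->
    exists G, prod_sigma G /\ (A `*` W) `&` (f @^-1` E) = (A `*` W) `&` G.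

Definition orlicz_integrand (phi : T -> X -> \bar R) : Prop :=
  [/\ (forall w x, (0 <= phi w x)%E),
      {ae mu, forall w,
        [/\ (forall x : X, phi w (- x) = phi w x) /\
            (forall (x y : X) (t : R), 0 <= t <= 1 ->
               (phi w (t *: x + (1 - t) *: y)%R <= t%:E * phi w x + (1 - t)%:E * phi w y)%E),
            (forall c : R, closed [set x | (phi w x <= c%:E)%E]),
            (exists x, (phi w x < +oo)%E),
            phi w x @[x --> (0 : X)^'] --> 0%E &
            (forall M : R, exists r : R, forall x, r < `|x| -> (M%:E < phi w x)%E)]} &
      forall A W, atoms_sfinite_union A -> separable_subset W ->
        trace_measurable (fun p => phi p.1 p.2) A W].

Definition simple_fun (s : T -> X) : Prop :=
  finite_set (range s) /\ forall x, measurable (s @^-1` [set x]).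

Definition strongly_measurable (u : T -> X) : Prop :=
  exists s : nat -> T -> X, (forall n, simple_fun (s n)) /\
    {ae mu, forall t, s n t @[n --> \oo] --> u t}.

Definition lux_norm (phi : T -> X -> \bar R) (u : T -> X) : \bar R :=
  ereal_inf [set a%:E | a in [set a : R |
     0 < a /\ (\int[mu]_t phi t (a^-1 *: u t) <= 1)%E]].

(* L_phi(mu), as a set of representatives *)
Definition Lphi (phi : T -> X -> \bar R) : set (T -> X) :=
  [set u | strongly_measurable u /\ (lux_norm phi u < +oo)%E].

Definition sigma_supported (u : T -> X) : Prop :=
  exists S, sigma_finite_set S /\ {ae mu, forall t, ~ S t -> u t = 0}.

Definition Lphi_sigma (phi : T -> X -> \bar R) : set (T -> X) :=
  Lphi phi `&` sigma_supported.

Definition Cphi (phi : T -> X -> \bar R) : set (T -> X) :=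
  [set u | Lphi phi u /\
    forall E : nat -> set T, (forall n, measurable (E n)) ->
      {ae mu, forall t, (\1_(E n) t : R) @[n --> \oo] --> 0} ->
      lux_norm phi (fun t => (\1_(E n) t : R) *: u t) @[n --> \oo] --> 0%E].

Definition Cphi_sigma (phi : T -> X -> \bar R) : set (T -> X) :=
  Cphi phi `&` sigma_supported.

(* separability of a subspace L of L_phi w.r.t. the Luxemburg (semi)norm,
   i.e. separability of the corresponding space of a.e.-classes *)
Definition lux_separable (phi : T -> X -> \bar R) (L : set (T -> X)) : Prop :=
  exists D : set (T -> X), [/\ countable D, D `<=` L &
    forall u, L u -> forall e : R, 0 < e ->
      exists2 v, D v & (lux_norm phi (fun t => (u t - v t)%R) < e%:E)%E].

End OrliczDefs.

(* Main.v *)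
(** Suppose [u] lies in [Lphi] but not in [Cphi].  Then there are [e > 0] and
    measurable sets [F n] decreasing to a null set on each of which the modular
    of [u / e] exceeds [1].  When each [F n] can be replaced by a sigma-finite
    subset, monotone convergence yields disjoint sigma-finite sets [S k] with
    the same property.  Given a dense sequence [v j], a function [w] equal to
    [u] or to [0] on each [S j], chosen by the size of [v j] there, stays at
    distance at least [e / 2] from every [v j]: a contradiction.

    The integral of a non-measurable nonnegative function is a lower integral:
    it is monotone, but subadditive only where measurability is known, that is,
    on sigma-finite sets.  If a reduction to a sigma-finite set is impossible,
    there is a set on which [phi t (u t / e)] is bounded below by a positive
    constant and whose measurable subsets all have measure [0] or [+oo].
    Absent infinite atoms it splits into infinitely many pieces of positive
    measure, and a diagonal argument avoiding the triangle inequality applies. *)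
Require Import Defs.
From HB Require Import structures.
From mathcomp Require Import all_boot all_order all_algebra.
From mathcomp Require Import all_classical all_reals all_analysis.
From mathcomp Require Import measurable_realfun.
Import Order.TTheory GRing.Theory Num.Theory.
Import numFieldNormedType.Exports.
Local Open Scope classical_set_scope.
Local Open Scope ring_scope.

Set Implicit Arguments.
Unset Strict Implicit.
Unset Printing Implicit Defensive.

(** * Lower integrals of nonnegative functions that need not be measurable *)

Section lower_integral.
Context {d : measure_display} {T : measurableType d} {R : realType}
  (mu : {measure set T -> \bar R}).
Implicit Types (f g : T -> \bar R) (D E N A S : set T).
Local Open Scope ereal_scope.
Import HBNNSimple.

(** A simple minorant of [f], cut off on a measurable null set containing [N], keeps its integral
    and lies below [g]; measurability is used only for the simple functions. *)
Lemma ge0_ae_le_lower_integral f g N :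
  (forall t, 0 <= f t) -> (forall t, 0 <= g t) -> mu.-negligible N ->
  (forall t, ~ N t -> f t <= g t) -> \int[mu]_t f t <= \int[mu]_t g t.
Proof.
move=> f0 g0 [M [mM M0 NM]] fg.
rewrite !ge0_integralTE//; apply: ge_ereal_sup => _ [h /= hf <-].
have mCM : measurable (~` M) by exact: measurableC.
have -> : sintegral mu h = sintegral mu (h \_ (~` M)).
  rewrite -integralT_nnsfun -integral_nnsfun//.
  rewrite (@ge0_negligible_integral _ _ _ _ _ M)//.
  - by rewrite setTD.
  - exact/measurable_EFinP.
  - by move=> t _; rewrite lee_fin; exact: fun_ge0.
apply: ereal_sup_ubound; exists (proj_nnsfun h mCM); last by rewrite -mrestrict.
move=> t; suff: ((h \_ (~` M)) t)%:E <= g t by rewrite mrestrict.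
rewrite /patch.
case: ifPn => [|_]; last exact: g0.
rewrite inE/= => Mt; apply: (le_trans (hf t)).
by apply: fg => /NM.
Qed.

Lemma le_lower_integral D E f g N :
  (forall t, 0 <= f t) -> (forall t, 0 <= g t) -> mu.-negligible N ->
  (forall t, D t -> ~ N t -> E t /\ f t <= g t) ->
  \int[mu]_(t in D) f t <= \int[mu]_(t in E) g t.
Proof.
move=> f0 g0 N0 fg; rewrite (integral_mkcond D) (integral_mkcond E).
apply: (@ge0_ae_le_lower_integral _ _ N) => //.
- by move=> t; apply: erestrict_ge0.
- by move=> t; apply: erestrict_ge0.
move=> t Nt; rewrite {1}/patch; case: ifPn => [|_].
  by rewrite inE => Dt; have [Et le] := fg t Dt Nt; rewrite /patch mem_set.
by apply: erestrict_ge0.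
Qed.

(** The function [h] is a measurable stand-in for [f]: its level sets are measurable and convergence
    theorems apply to it. *)
Lemma lower_integral_gt D f r :
  (forall t, 0 <= f t) -> r < \int[mu]_(t in D) f t ->
  exists h : T -> R, [/\ measurable_fun setT h, forall t, (0 <= h t)%R,
    forall t, D t -> (h t)%:E <= f t, forall t, ~ D t -> h t = 0%R &
    r < \int[mu]_t (h t)%:E].
Proof.
move=> f0; rewrite ge0_integralE// => /ereal_sup_gt[_ [h /= hf <-] rh].
have h0 t : (0 <= h t)%R by exact: fun_ge0.
exists h; split=> //.
- by move=> t Dt; have := hf t; rewrite /patch mem_set.
- move=> t Dt; have := hf t; rewrite /patch memNset// lee_fin => ht.
  by apply/eqP; rewrite eq_le ht h0.
- by rewrite integralT_nnsfun.
Qed.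

(** Monotone convergence is applied to a measurable minorant of [f] along the increasing sets
    [D \ F n], which exhaust [D] up to a null set. *)
Lemma lower_integral_tail_gt D f r (F : nat -> set T) :
  (forall t, 0 <= f t) -> measurable D -> (forall n, measurable (F n)) ->
  (forall m n, (m <= n)%N -> F n `<=` F m) -> mu.-negligible (\bigcap_n F n) ->
  r < \int[mu]_(t in D) f t -> exists m, r < \int[mu]_(t in D `\` F m) f t.
Proof.
move=> f0 mD mF decF [M [mM M0 FM]] /(lower_integral_gt f0)[h [mh h0 hf hD rh]].
pose G n := D `\` F n.
have mG n : measurable (G n) by exact: measurableD.
have mh' A : measurable_fun A (EFin \o h).
  by apply/measurable_EFinP; exact: (measurable_funS measurableT).
have ndG : nondecreasing_seq G.
  move=> m n mn; apply/subsetPset => t [Dt nF]; split=> // /(decF _ _ mn).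
  exact: nF.
have cvgG := @ge0_nondecreasing_set_cvg_integral _ _ _ G (EFin \o h) mu ndG
  mG (fun n => mh' _) (fun n t _ => h0 t).
have mUG : measurable (\bigcup_n G n) by exact: bigcupT_measurable.
have le1 : \int[mu]_t (h t)%:E <= \int[mu]_(t in \bigcup_n G n) (h t)%:E.
  rewrite (integral_mkcond (\bigcup_n G n)).
  apply: (@ge0_ae_le_lower_integral _ _ M) => //.
  - by move=> t; apply: erestrict_ge0 => x _; rewrite lee_fin.
  - by exists M; split.
  move=> t nMt; have [Dt|nDt] := pselect (D t).
    rewrite /patch mem_set//.
    apply: contrapT => nG; apply: nMt; apply: FM => n _.
    by apply: contrapT => nF; apply: nG; exists n.
  by rewrite hD//; apply: erestrict_ge0 => x _; rewrite lee_fin.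
have rU := lt_le_trans rh le1.
have [n _ /(_ n (leqnn n)) /= rn] :=
  cvgG _ (open_nbhs_nbhs (conj (@open_ereal_gt_ereal _ r) rU)).
exists n; apply: lt_le_trans rn _.
apply: (@le_lower_integral _ _ _ _ set0) => //; last first.
  by move=> t [Dt nF] _; split=> //; exact: hf.
exact: negligible_set0.
Qed.
End lower_integral.

(** * Sigma-finite subsets versus purely infinite sets, whose measurable subsets all have measure
    [0] or [+oo] *)

Section sigma_finite_sets.
Context {d : measure_display} {T : measurableType d} {R : realType}
  (mu : {measure set T -> \bar R}).
Implicit Types (f : T -> \bar R) (A B D S P Q : set T).
Local Open Scope ereal_scope.

Lemma sigma_finite_set_measurable S : sigma_finite_set mu S -> measurable S.
Proof. by move=> [F [mF ->]]; apply: bigcupT_measurable => n; have [] := mF n. Qed.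

Lemma sigma_finite_setIl A S :
  measurable A -> sigma_finite_set mu S -> sigma_finite_set mu (A `&` S).
Proof.
move=> mA [F [mF ->]]; exists (fun n => A `&` F n); split; last first.
  by rewrite setI_bigcupr.
move=> n; have [mFn Fn] := mF n; split; first exact: measurableI.
by apply: le_lt_trans Fn; apply: le_measure; rewrite ?inE//; exact: measurableI.
Qed.

(** Otherwise the measures of the finite-measure subsets are bounded by [M], and the union of a
    maximizing sequence attains their supremum. The rest of [A] has positive measure, and a piece of
    it of finite positive measure would push the union above the supremum. *)
Lemma exhaust_infinite_measure A (M : R) :
  measurable A -> mu A = +oo ->
  (forall P, measurable P -> P `<=` A -> 0 < mu P ->
    exists Q, [/\ measurable Q, Q `<=` P, 0 < mu Q & mu Q < +oo]) ->
  exists S, [/\ measurable S, S `<=` A, sigma_finite_set mu S & M%:E < mu S].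
Proof.
move=> mA muA subA; apply: contrapT => noS.
pose W := [set mu S | S in [set S | [/\ measurable S, S `<=` A & mu S < +oo]]].
have sf S : measurable S -> mu S < +oo -> sigma_finite_set mu S.
  by move=> mS muS; exists (fun=> S); split=> //; rewrite bigcup_const//; exists 0%N.
have ltM S : measurable S -> S `<=` A -> sigma_finite_set mu S -> mu S <= M%:E.
  by move=> mS SA sS; rewrite leNgt; apply/negP => MS; apply: noS; exists S.
have W0 : W 0.
  by exists set0; rewrite ?measure0//; split=> //; rewrite measure0 ltry.
have supM : ereal_sup W <= M%:E.
  by apply: ge_ereal_sup => _ [S [mS SA fS] <-]; apply: ltM => //; exact: sf.
have supfin : ereal_sup W \is a fin_num.
  by rewrite ge0_fin_numE ?(le_lt_trans supM) ?ltry//; exact: (ereal_sup_ubound W0).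
have /choice[F HF] : forall n : nat, exists S,
    [/\ measurable S, S `<=` A, mu S < +oo & ereal_sup W - n.+1%:R^-1%:E < mu S].
  move=> n; have n0 : (0 < n.+1%:R^-1 :> R)%R by rewrite invr_gt0.
  by have [_ [S [mS SA fS] <-] lt] := ub_ereal_sup_adherent n0 supfin; exists S.
pose S := \bigcup_n F n.
have mS : measurable S by apply: bigcupT_measurable => n; have [] := HF n.
have SA : S `<=` A by move=> t [n _ Ft]; have [_ + _ _] := HF n; exact.
have SM : mu S <= M%:E.
  by apply: ltM => //; exists F; split=> // n; have [] := HF n.
have Sfin : mu S < +oo by rewrite (le_lt_trans SM)// ltry.
have supS : ereal_sup W <= mu S.
  apply/lee_addgt0Pr => e e0; have [n ne] := ltr_add_invr e0.
  have [mFn _ _ /ltW lt] := HF n.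
  rewrite -leeBlDr//; apply: le_trans (le_trans lt _).
    by rewrite leeB// lee_fin ltW//; move: ne; rewrite add0r.
  by apply: le_measure; rewrite ?inE//; exact: bigcup_sup.
have [Q [mQ QD Q0 Qfin]] : exists Q,
    [/\ measurable Q, Q `<=` A `\` S, 0 < mu Q & mu Q < +oo].
  apply: subA; [exact: measurableD|exact: subDsetl|].
  rewrite lt0e measure_ge0 andbT; apply/eqP => D0.
  have : mu A <= mu (A `\` S) + mu S.
    rewrite -measureU//; last 2 first.
    - exact: measurableD.
    - by rewrite setDKI.
    by apply: le_measure; rewrite ?inE//;
      [apply: measurableU => //; exact: measurableD|rewrite setUC setDUK].
  by rewrite D0 add0e muA leNgt Sfin.
have : mu (S `|` Q) <= ereal_sup W.
  apply: ereal_sup_ubound; exists (S `|` Q) => //; split; first exact: measurableU.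
    by move=> t [/SA//|/QD[]].
  by apply: le_lt_trans (measureU2 _ _ _) _ => //; rewrite lte_add_pinfty.
rewrite measureU//; last first.
  by rewrite -subset0 => t [St /QD[]].
move=> /le_trans/(_ supS); rewrite leNgt lteDl ?ge0_fin_numE// Q0; exact.
Qed.

(** The level sets [H n] of a simple minorant [h] decide. If all have finite measure, their union is
    sigma-finite and carries the whole integral of [h]. One of infinite measure either is exhausted
    by sets of finite measure, or contains a set of positive measure none of whose subsets has
    finite positive measure. *)
Lemma sigma_finite_or_purely_infinite f D (r : R) :
  (0 <= r)%R -> (forall t, 0 <= f t) -> measurable D ->
  r%:E < \int[mu]_(t in D) f t ->
  (exists S, [/\ measurable S, S `<=` D, sigma_finite_set mu S &
     r%:E < \int[mu]_(t in S) f t]) \/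
  (exists A (c : R), [/\ (0 < c)%R, measurable A /\ A `<=` D, 0 < mu A,
     forall t, A t -> c%:E <= f t &
     forall B, measurable B -> B `<=` A -> mu B = 0 \/ mu B = +oo]).
Proof.
move=> r0 f0 mD /(lower_integral_gt f0)[h [mh h0 hf hD rh]].
pose H n := [set t | (n.+1%:R^-1 <= h t)%R].
have mH n : measurable (H n).
  have := mh measurableT _ (@measurable_itv R `[n.+1%:R^-1%R, +oo[).
  by rewrite setTI set_itvcy.
have n0 n : (0 < n.+1%:R^-1 :> R)%R by rewrite invr_gt0.
have HD n : H n `<=` D.
  by move=> t Ht; apply: contrapT => /hD ht; move: Ht; rewrite /H/= ht leNgt n0.
have HT : \bigcup_n H n = [set t | (0 < h t)%R].
  apply/seteqP; split=> t /=; first by move=> [n _]; exact: lt_le_trans.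
  by move=> /ltr_add_invr[n]; rewrite add0r => /ltW ht; exists n.
have [[n Hn]|Hfin] := pselect (exists n, mu (H n) = +oo); last first.
  left; exists (\bigcup_n H n); split.
  - exact: bigcupT_measurable.
  - by move=> t [n _]; exact: HD.
  - exists H; split=> // n; split=> //; rewrite ltey; apply/eqP => Hn.
    by apply: Hfin; exists n.
  apply: lt_le_trans rh _.
  rewrite (integral_mkcond (\bigcup_n H n)).
  apply: (@ge0_ae_le_lower_integral _ _ _ _ _ _ set0) => //.
  - by move=> t; apply: erestrict_ge0.
  - exact: negligible_set0.
  move=> t _; rewrite /patch; case: ifPn; rewrite HT.
    rewrite inE/= => ht; apply: hf; apply: contrapT => /hD h0t.
    by rewrite h0t ltxx in ht.
  by rewrite notin_setE/= => /negP; rewrite -leNgt lee_fin.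
have [sub|] := pselect (forall P, measurable P -> P `<=` H n -> 0 < mu P ->
    exists Q, [/\ measurable Q, Q `<=` P, 0 < mu Q & mu Q < +oo]).
  (* Since [h] is at least [n.+1%:R^-1] on [S], a measure above [r * n.+1%:R] forces an integral
     above [r]. *)
  left; have [S [mS SH sS lt]] := exhaust_infinite_measure (r * n.+1%:R) (mH n) Hn sub.
  exists S; split=> //; first by move=> t /SH /HD.
  apply: (@lt_le_trans _ _ (\int[mu]_(t in S) cst (n.+1%:R^-1)%:E t)).
    rewrite integral_cst//; move: lt; rewrite EFinM.
    have [->|Soo] := eqVneq (mu S) +oo.
      by move=> _; rewrite gt0_muley// ?ltry// lte_fin.
    have Sf : mu S \is a fin_num by rewrite ge0_fin_numE// ltey.
    rewrite -(fineK Sf) -!EFinM !lte_fin => lt.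
    by rewrite mulrC ltr_pdivlMr.
  apply: (@le_lower_integral _ _ _ _ _ _ _ _ set0) => //.
  - by move=> t; rewrite lee_fin ltW.
  - exact: negligible_set0.
  - move=> t St _; split=> //=; apply: (@le_trans _ _ (h t)%:E).
      by rewrite lee_fin; exact: SH.
    by apply: hf; apply: HD (SH _ St).
move=> /existsNP[P] /not_implyP[mP] /not_implyP[PH] /not_implyP[P0 noQ].
right; exists P, (n.+1%:R^-1)%R; split=> //.
- by split=> // t /PH /HD.
- move=> t Pt; apply: (@le_trans _ _ (h t)%:E).
    by rewrite lee_fin; exact: PH.
  by apply: hf; apply: HD (PH _ Pt).
- move=> B mB BP; have [->|B0] := eqVneq (mu B) 0; first by left.
  right; apply/eqP; rewrite -leye_eq leNgt; apply/negP => Boo; apply: noQ; exists B.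
  by split=> //; rewrite lt0e B0 measure_ge0.
Qed.

(** A subset of [A] of positive measure has infinite measure, so it is not an atom and splits into
    two parts of positive measure. One part is split again, giving the decreasing sets [Q n]; the
    parts left over are the desired pieces. *)
Lemma purely_infinite_split A :
  measurable A -> 0 < mu A ->
  (forall B, measurable B -> B `<=` A -> mu B = 0 \/ mu B = +oo) ->
  (forall B, atom mu B -> mu B < +oo) ->
  exists P : nat -> set T, [/\ forall n, measurable (P n), forall n, P n `<=` A,
    forall n, 0 < mu (P n) & trivIset setT P].
Proof.
move=> mA A0 Aoo noatom.
pose good B := [/\ measurable B, B `<=` A & 0 < mu B].
have /choice[g Hg] : forall B, exists C, good B ->
    [/\ good C, C `<=` B & 0 < mu (B `\` C)].
  move=> B; have [[mB BA B0]|] := pselect (good B); last by exists set0.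
  have : ~ atom mu B.
    move=> aB; have := noatom _ aB.
    by case: (Aoo _ mB BA) => muB; [rewrite muB ltxx in B0|rewrite muB ltxx].
  have pos C : measurable C -> mu C <> 0 -> 0 < mu C.
    by move=> mC /eqP C0; rewrite lt0e C0 measure_ge0.
  move=> natom; apply: contrapT => noC; apply: natom; split=> // C mC CB.
  have [C0|C0] := pselect (mu C = 0); first by left.
  right; apply: contrapT => BC0; apply: noC; exists C => _.
  split=> //; first by split=> //; [exact: subset_trans BA|exact: pos].
  by apply: pos => //; exact: measurableD.
pose Q n := iter n g A.
have goodQ n : good (Q n) by elim: n => [|n /Hg[]//]; split.
have decQ m n : (m <= n)%N -> Q n `<=` Q m.
  elim: n => [|n IH]; first by rewrite leqn0 => /eqP ->.
  rewrite leq_eqVlt ltnS => /predU1P[->//|/IH]; apply: subset_trans.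
  by have [] := Hg _ (goodQ n).
exists (fun n => Q n `\` Q n.+1); split.
- by move=> n; apply: measurableD; [have [] := goodQ n|have [] := goodQ n.+1].
- by move=> n t [Qt _]; have [_ + _] := goodQ n; exact.
- by move=> n; have [] := Hg _ (goodQ n).
- apply: ltn_trivIset => n m mn; rewrite -subset0 => t [[_ nQ] [Qt _]].
  exact: nQ (decQ _ _ mn _ Qt).
Qed.
End sigma_finite_sets.

(** * Lower integrals over purely infinite sets *)

Section purely_infinite.
Context {d : measure_display} {T : measurableType d} {R : realType}
  (mu : {measure set T -> \bar R}).
Implicit Types (f : T -> \bar R) (A B D N S : set T).
Local Open Scope ereal_scope.

Lemma purely_infinite_integral f B (c : R) :
  (forall t, 0 <= f t) -> measurable B -> mu B = +oo -> (0 < c)%R ->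
  (forall t, B t -> c%:E <= f t) -> \int[mu]_(t in B) f t = +oo.
Proof.
move=> f0 mB Boo c0 cf; apply/eqP; rewrite -leye_eq.
rewrite -(@gt0_muley _ c%:E)// -Boo -integral_cst//.
apply: (@le_lower_integral _ _ _ _ _ _ _ _ set0) => //.
- by move=> t; rewrite lee_fin ltW.
- exact: negligible_set0.
- by move=> t Bt _; split=> //; exact: cf.
Qed.

(** A level set of a simple minorant meets [P j] in measure [0] or [+oo], and [+oo] would make the
    integral over [P j] infinite. Hence every minorant vanishes almost everywhere, however large the
    sum of the finite integrals over the pieces may look. *)
Lemma purely_infinite_integral_bigcup f A (P : nat -> set T) N :
  (forall B, measurable B -> B `<=` A -> mu B = 0 \/ mu B = +oo) ->
  (forall j, measurable (P j)) -> (forall j, P j `<=` A) ->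
  (forall t, 0 <= f t) -> mu.-negligible N ->
  (forall t, ~ (\bigcup_j P j) t -> ~ N t -> f t = 0) ->
  (forall j, \int[mu]_(t in P j) f t < +oo) ->
  \int[mu]_t f t <= 0.
Proof.
move=> Aoo mP PA f0 negN fN Pfin.
rewrite leNgt; apply/negP => /(lower_integral_gt f0)[h [mh h0 hf _ hpos]].
pose H n := [set t | (n.+1%:R^-1 <= h t)%R].
have mH n : measurable (H n).
  have := mh measurableT _ (@measurable_itv R `[n.+1%:R^-1%R, +oo[).
  by rewrite setTI set_itvcy.
have HP0 n j : mu (H n `&` P j) = 0.
  have mHP : measurable (H n `&` P j) by exact: measurableI.
  have HPA : H n `&` P j `<=` A by move=> t [_ /PA].
  have [//|HPoo] := Aoo _ mHP HPA.
  have : \int[mu]_(t in H n `&` P j) f t <= \int[mu]_(t in P j) f t.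
    apply: (@le_lower_integral _ _ _ _ _ _ _ _ set0) => //.
    - exact: negligible_set0.
    - by move=> t [].
  rewrite (@purely_infinite_integral _ _ n.+1%:R^-1)//.
  - by rewrite leye_eq => /eqP Poo; have := Pfin j; rewrite Poo.
  - by move=> t [Ht _]; apply: le_trans (hf t _) => //; rewrite lee_fin.
have negHP : mu.-negligible (\bigcup_n \bigcup_j (H n `&` P j)).
  apply: negligible_bigcup => n; apply: negligible_bigcup => j.
  by exists (H n `&` P j); split=> //; exact: measurableI.
have : \int[mu]_t (h t)%:E <= \int[mu]_t cst 0 t.
  apply: (@ge0_ae_le_lower_integral _ _ _ _ _ _ _ _ _ (negligibleU negN negHP)) => //.
  move=> t /not_orP[Nt nHP] /=.
  have [[j _ Pj]|nP] := pselect ((\bigcup_j P j) t); last first.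
    by rewrite -(fN t)//; exact: hf.
  rewrite lee_fin leNgt; apply/negP => /ltr_add_invr[n]; rewrite add0r => hn.
  by apply: nHP; exists n => //; exists j => //; split=> //; exact: ltW.
by rewrite integral_cst// mul0e leNgt hpos.
Qed.
End purely_infinite.

(** * Extraction of disjoint sigma-finite sets from a decreasing sequence *)

Section disjoint_pieces.
Context {d : measure_display} {T : measurableType d} {R : realType}
  (mu : {measure set T -> \bar R}).
Local Open Scope ereal_scope.

(** The integral over [F n] still exceeds [r] once a later [F m] is removed. A sigma-finite set is
    chosen in the difference, and the choice is repeated from the later index. *)
Lemma disjoint_sigma_finite_pieces (f : T -> \bar R) r (F : nat -> set T) :
  (forall t, 0 <= f t) -> (forall n, measurable (F n)) ->
  (forall m n, (m <= n)%N -> F n `<=` F m) -> mu.-negligible (\bigcap_n F n) ->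
  (forall n, r < \int[mu]_(t in F n) f t) ->
  (forall D, measurable D -> r < \int[mu]_(t in D) f t ->
    exists S, [/\ measurable S, S `<=` D, sigma_finite_set mu S &
      r < \int[mu]_(t in S) f t]) ->
  exists S : nat -> set T, [/\ forall k, measurable (S k), trivIset setT S,
    forall k, sigma_finite_set mu (S k) & forall k, r < \int[mu]_(t in S k) f t].
Proof.
move=> f0 mF decF F0 rF sub.
have /choice[g Hg] : forall n, exists mS : nat * set T, (n <= mS.1)%N /\
    [/\ measurable mS.2, mS.2 `<=` F n `\` F mS.1, sigma_finite_set mu mS.2 &
      r < \int[mu]_(t in mS.2) f t].
  move=> n; have [m rm] := lower_integral_tail_gt f0 (mF n) mF decF F0 (rF n).
  have [S [mS SF sS rS]] := sub _ (measurableD (mF n) (mF m)) rm.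
  (* Recording [maxn m n] instead of [m] makes the successive indices [q k] nondecreasing. *)
  exists (maxn m n, S); rewrite leq_maxr; split=> //; split=> // t /SF[Fn nFm].
  by split=> // /decF; apply: contra_not nFm; apply; rewrite leq_maxl.
pose q k := iter k (fun n => (g n).1) 0%N.
have leq_q j k : (j <= k)%N -> (q j <= q k)%N.
  elim: k => [|k IH]; first by rewrite leqn0 => /eqP ->.
  rewrite leq_eqVlt ltnS => /predU1P[->//|/IH/leq_trans]; apply.
  exact: (Hg (q k)).1.
exists (fun k => (g (q k)).2); split; try by move=> k; have [_ []] := Hg (q k).
apply: ltn_trivIset => n m mn; rewrite -subset0 => t [Sm Sn].
have [_ [_ /(_ t Sm)[_ nF] _ _]] := Hg (q m).
have [_ [_ /(_ t Sn)[Fn _] _ _]] := Hg (q n).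
exact: nF (decF _ _ (leq_q m.+1 n mn) _ Fn).
Qed.
End disjoint_pieces.

(** * Strongly measurable functions and their superposition with an Orlicz integrand *)

Section strong_measurability.
Context {d : measure_display} {T : measurableType d} {R : realType}
  (mu : {measure set T -> \bar R}) {X : completeNormedModType R}.
Implicit Types (s u v w : T -> X) (P S : set T).

Lemma simple_fun_preimage s (A : set X) : simple_fun s -> measurable (s @^-1` A).
Proof.
move=> [fs ms].
have -> : s @^-1` A = \bigcup_(x in range s `&` A) (s @^-1` [set x]).
  apply/seteqP; split=> t /=; first by move=> At; exists (s t).
  by move=> [x [_ Ax] /= ->].
by apply: fin_bigcup_measurable => //; exact: finite_setIl.
Qed.

(** An arbitrary [g] is allowed because a simple function, having finite range, pulls every subset
    of [X] back to a measurable set. *)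
Lemma simple_fun_map2 (g : X -> X -> X) s1 s2 :
  simple_fun s1 -> simple_fun s2 -> simple_fun (fun t => g (s1 t) (s2 t)).
Proof.
move=> h1 h2; split.
  have := finite_image2 g h1.1 h2.1; apply: sub_finite_set => _ [t _ <-].
  by exists (s1 t) => //; exists (s2 t).
move=> z; have -> : (fun t => g (s1 t) (s2 t)) @^-1` [set z] =
    \bigcup_(x in range s1) (s1 @^-1` [set x] `&` s2 @^-1` [set y | g x y = z]).
  apply/seteqP; split=> t /=; first by move=> gz; exists (s1 t).
  by move=> [x _ [/= -> ]].
apply: fin_bigcup_measurable => [|x _]; first exact: h1.1.
by apply: measurableI; exact: simple_fun_preimage.
Qed.

Lemma simple_fun_if P s1 s2 : measurable P ->
  simple_fun s1 -> simple_fun s2 ->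
  simple_fun (fun t => if t \in P then s1 t else s2 t).
Proof.
move=> mP h1 h2; split.
  have : finite_set (range s1 `|` range s2) by rewrite finite_setU; case: h1; case: h2.
  apply: sub_finite_set => _ [t _ <-].
  by case: ifP => _; [left|right]; exists t.
move=> z; have -> : (fun t => if t \in P then s1 t else s2 t) @^-1` [set z] =
    (P `&` s1 @^-1` [set z]) `|` (~` P `&` s2 @^-1` [set z]).
  apply/seteqP; split=> t /=; case: ifPn; rewrite ?inE ?notin_setE /=.
  - by left.
  - by right.
  - by move=> Pt [[]|[]].
  - by move=> Pt [[]|[]].
apply: measurableU; apply: measurableI => //; [exact: h1.2|exact: measurableC|exact: h2.2].
Qed.

Lemma simple_fun_cst (x : X) : simple_fun (fun _ : T => x).
Proof.
split; first by apply: (@sub_finite_set _ _ [set x]) => // _ [t _ <-].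
move=> y; have [->|xy] := pselect (x = y).
  by rewrite (_ : _ @^-1` _ = setT)//; apply/seteqP; split.
by rewrite (_ : _ @^-1` _ = set0)//; apply/seteqP; split.
Qed.

Lemma strongly_measurableD u v : strongly_measurable mu u ->
  strongly_measurable mu v -> strongly_measurable mu (fun t => u t + v t).
Proof.
move=> [s1 [h1 l1]] [s2 [h2 l2]]; exists (fun n t => s1 n t + s2 n t); split.
  by move=> n; exact: simple_fun_map2.
by apply: filterS2 l1 l2 => t; exact: cvgD.
Qed.

Lemma strongly_measurableZ (a : R) u : strongly_measurable mu u ->
  strongly_measurable mu (fun t => a *: u t).
Proof.
move=> [s1 [h1 l1]]; exists (fun n t => a *: s1 n t); split.
  move=> n; exact: (simple_fun_map2 (fun x _ => a *: x) (h1 n) (h1 n)).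
by apply: filterS l1 => t; apply: cvgZ; exact: cvg_cst.
Qed.

Lemma strongly_measurableN u : strongly_measurable mu u ->
  strongly_measurable mu (fun t => - u t).
Proof.
move=> /(strongly_measurableZ (-1)); congr strongly_measurable.
by apply/funext => t; rewrite scaleN1r.
Qed.

Lemma strongly_measurableB u v : strongly_measurable mu u ->
  strongly_measurable mu v -> strongly_measurable mu (fun t => u t - v t).
Proof. by move=> hu /strongly_measurableN; exact: strongly_measurableD. Qed.

Lemma strongly_measurable_glue (u : nat -> T -> X) (P : nat -> set T) :
  (forall j, measurable (P j)) -> trivIset setT P ->
  (forall j, strongly_measurable mu (u j)) ->
  exists w, [/\ strongly_measurable mu w, forall j t, P j t -> w t = u j t &
    forall t, ~ (\bigcup_j P j) t -> w t = 0].
Proof.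
move=> mP tP /choice[s Hs].
have /choice[w Hw] : forall t, exists x, (forall j, P j t -> x = u j t) /\
    (~ (\bigcup_j P j) t -> x = 0).
  move=> t; have [[j _ Pj]|nP] := pselect ((\bigcup_j P j) t).
    exists (u j t); split=> [k Pk|[]]; last by exists j.
    by have -> : j = k by apply: tP => //; exists t.
  by exists 0; split=> // j Pj; case: nP; exists j.
have wP j t : P j t -> w t = u j t by exact: (Hw t).1.
have w0 t : ~ (\bigcup_j P j) t -> w t = 0 by exact: (Hw t).2.
exists w; split=> //.
(* [G n k] glues the [n]-th approximants over the first [k] pieces only, and so has finite range. *)
pose fix G n k : T -> X := if k is j.+1 then
  (fun t => if t \in P j then s j n t else G n j t) else (fun=> 0).
have simpleG n k : simple_fun (G n k).
  elim: k => [|k IH]; first exact: simple_fun_cst.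
  by apply: simple_fun_if => //; exact: (Hs k).1.
have GP n k j t : P j t -> (j < k)%N -> G n k t = s j n t.
  move=> Pt; elim: k => // k IH jk /=; case: ifPn; rewrite ?inE ?notin_setE => Pk.
    by have -> : k = j by apply: tP => //; exists t.
  by apply: IH; move: jk; rewrite ltnS leq_eqVlt => /predU1P[jk|//]; rewrite jk in Pt.
have G0 n k t : ~ (\bigcup_j P j) t -> G n k t = 0.
  move=> nP; elim: k => // k IH /=; rewrite memNset//.
  by move=> Pk; apply: nP; exists k.
(* On [P j] the diagonal sequence agrees with [s j n] as soon as [n > j], hence has the same limit
   wherever [s j] converges. *)
exists (fun n => G n n); split=> //.
have : mu.-negligible (\bigcup_j ~` [set t | s j n t @[n --> \oo] --> u j t]).
  by apply: negligible_bigcup => j; exact: (Hs j).2.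
apply: negligibleS => t /= nG.
apply: contrapT => nU; apply: nG.
have [[j _ Pj]|nP] := pselect ((\bigcup_j P j) t); last first.
  by rewrite w0//; under eq_fun do rewrite G0//; exact: cvg_cst.
rewrite (wP j)//.
have cs : s j n t @[n --> \oo] --> u j t.
  by apply: contrapT => ns; apply: nU; exists j.
apply: cvg_trans cs; apply: near_eq_cvg.
by exists j.+1 => // n /= jn; rewrite (GP _ _ j).
Qed.

Lemma limit_preimage_open (s : nat -> T -> X) u (N : set T) (O : set X) :
  (forall n, simple_fun (s n)) -> measurable N ->
  (forall t, ~ N t -> s n t @[n --> \oo] --> u t) -> open O ->
  measurable (~` N `&` u @^-1` O).
Proof.
move=> hs mN su oO.
(* [Ok k] is [O] shrunk by a uniform margin. The limit lies in [O] exactly when the sequence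
   eventually stays in one fixed [Ok k]. *)
pose Ok k := [set x | ball x (k.+1%:R^-1 : R) `<=` O].
have -> : ~` N `&` u @^-1` O = ~` N `&`
    \bigcup_k \bigcup_m \bigcap_(n in [set n | (m <= n)%N]) (s n @^-1` Ok k).
  apply/seteqP; split=> t [Nt /= Ht]; split=> //.
    have /nbhs_ballP[e /= e0 eO] : nbhs (u t) O by exact: open_nbhs_nbhs.
    have e20 : 0 < e / 2 by rewrite divr_gt0.
    have [k] := ltr_add_invr e20; rewrite add0r => ke.
    have [m _ mk] := (@cvg_ball _ _ _ _ _ _ _ (su t Nt) _ e20).
    exists k => //; exists m => // n /= mn x kx; apply: eO.
    rewrite (splitr e); apply: ball_triangle (mk n mn) _.
    by apply: le_ball kx; exact: ltW.
  have [k _ [m _ H]] := Ht.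
  have k0 : 0 < k.+1%:R^-1 :> R by rewrite invr_gt0.
  have [m' _ mk] := (@cvg_ball _ _ _ _ _ _ _ (su t Nt) _ k0).
  apply: (H (maxn m m')); first by rewrite /= leq_maxl.
  by apply: ball_sym; apply: mk; rewrite /= leq_maxr.
apply: measurableI; first exact: measurableC.
apply: bigcupT_measurable => k; apply: bigcupT_measurable => m.
by apply: bigcap_measurable => [|n _]; [exists m => /=|exact: simple_fun_preimage].
Qed.

(** Off a null set [u] takes its values in the closure of the countably many values of its
    approximants. This closure is separable, so the integrand is product measurable on [S] times it,
    and pulling back along [t] to [(t, u t)] preserves measurability. *)
Lemma measurable_superposition (phi : T -> X -> \bar R) S u :
  orlicz_integrand mu phi -> sigma_finite_set mu S -> measurable S ->
  strongly_measurable mu u ->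
  exists N, [/\ measurable N, mu N = 0%E &
    measurable_fun (S `\` N) (fun t => phi t (u t))].
Proof.
move=> [_ _ mphi] sS mS [s [hs [N [mN N0 sN]]]].
have su t : ~ N t -> s n t @[n --> \oo] --> u t.
  by move=> Nt; apply: contrapT => /sN.
exists N; split=> // mSN E mE.
pose D := \bigcup_n range (s n).
have cD : countable D.
  by apply: bigcup_countable => // n _; apply: finite_set_countable; exact: (hs n).1.
have sepD : separable_subset (closure D).
  by exists D; split=> //; exact: subset_closure.
have aS : atoms_sfinite_union mu S.
  by exists set0, S; split=> //; rewrite bigcup_set0 set0U.
have uD t : ~ N t -> closure D (u t).
  move=> Nt; apply: (closed_cvg _ (@closed_closure _ D) _ _ (su t Nt)).
  by apply: nearW => n; apply: subset_closure; exists n => //; exists t.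
have [G [pG EG]] := mphi _ _ aS sepD E mE.
have -> : (S `\` N) `&` (fun t => phi t (u t)) @^-1` E =
    S `&` (~` N `&` [set t | G (t, u t)]).
  apply/seteqP; split=> t /=.
    move=> [[St Nt] Et]; have : ((S `*` closure D) `&` G) (t, u t).
      by rewrite -EG; split=> //=; split=> //=; exact: uD.
    by move=> [].
  move=> [St [Nt Gt]]; have : ((S `*` closure D) `&` G) (t, u t).
    by split=> //=; split=> //=; exact: uD.
  by rewrite -EG => -[].
apply: measurableI => //; have mNC : measurable (~` N) by exact: measurableC.
(* The sets [B] with this property form a sigma-algebra containing the open sets. The same
   principle, started from rectangles, then handles [G]. *)
have borel (B : set X) : borelX B -> measurable (~` N `&` u @^-1` B).
  apply: (@smallest_sub _ _ _ [set B | measurable (~` N `&` u @^-1` B)]); last first.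
    by move=> O oO; exact: limit_preimage_open hs mN su oO.
  split.
  - by rewrite /= preimage_set0 setI0.
  - move=> A /= mA; rewrite setTD preimage_setC -setDE.
    rewrite -[X in measurable X]set0U -(setDv (~` N)) -setDIr.
    exact: measurableD.
  - by move=> A /= mA; rewrite preimage_bigcup setI_bigcupr; exact: bigcupT_measurable.
move: pG.
apply: (@smallest_sub _ _ _ [set Z | measurable (~` N `&` [set t | Z (t, u t)])]).
  split.
  - by rewrite /= (_ : [set t | _] = set0) ?setI0.
  - move=> A /= mA; rewrite (_ : _ `&` _ = ~` N `\` (~` N `&` [set t | A (t, u t)])).
      exact: measurableD.
    apply/seteqP; split=> t /= [Nt nA]; split=> //.
      by case: nA => _ nA [_ /nA].
    by split=> // At; apply: nA.
  - move=> A /= mA; rewrite (_ : _ `&` _ = \bigcup_n (~` N `&` [set t | A n (t, u t)])).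
      exact: bigcupT_measurable.
    apply/seteqP; split=> t /=; first by move=> [Nt [n _ An]]; exists n.
    by move=> [n _ [Nt An]]; split=> //; exists n.
move=> _ [M mM [B bB <-]] /=.
rewrite (_ : _ `&` _ = M `&` (~` N `&` u @^-1` B)).
  by apply: measurableI => //; exact: borel.
by apply/seteqP; split=> t /= [? []].
Qed.
End strong_measurability.

(** * Pointwise properties of Orlicz integrands and first properties of the Luxemburg norm *)

Section orlicz.
Context {d : measure_display} {T : measurableType d} {R : realType}
  (mu : {measure set T -> \bar R}) {X : completeNormedModType R}
  (phi : T -> X -> \bar R).
Hypothesis phiP : orlicz_integrand mu phi.
Implicit Types (u v w : T -> X) (A B D S N : set T) (e : R).

Let phi0 t x : (0 <= phi t x)%E.
Proof. by case: phiP. Qed.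

(** By evenness and midpoint convexity [phi t] is smallest at [0]; its limit along nonzero vectors
    tending to [0] then forces [phi t 0 = 0]. The vector [x0] supplies such vectors. Monotonicity
    under scaling is convexity between [x] and [0]. *)
Lemma orlicz_integrand_regular (x0 : X) : x0 != 0 ->
  exists2 N, mu.-negligible N & forall t, ~ N t ->
    [/\ phi t 0 = 0%E, forall x, phi t (- x) = phi t x,
        forall x y, (phi t (2^-1 *: (x + y)) <=
                     2^-1%:E * phi t x + 2^-1%:E * phi t y)%E &
        forall (a : R) x, 0 <= a <= 1 -> (phi t (a *: x) <= phi t x)%E].
Proof.
move=> x00; have [_ [N [mN N0 HN]] _] := phiP.
exists N; first by exists N; split.
move=> t Nt; have /contrapT[[even conv] _ _ lim0 _] := contra_not (@HN t) Nt.
have half2 : (2^-1 + 2^-1 : R) = 1 by rewrite [RHS](splitr 1) mul1r.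
have half1 : (1 - 2^-1 : R) = 2^-1 by rewrite -[X in X - _]half2 addrK.
have half01 : 0 <= (2^-1 : R) <= 1 by rewrite invr_ge0 ler0n invf_le1 ?ler1n.
have mid x y : (phi t (2^-1 *: (x + y)) <=
                 2^-1%:E * phi t x + 2^-1%:E * phi t y)%E.
  by have := conv x y _ half01; rewrite half1 scalerDr.
have phi0le x : (phi t 0%R <= phi t x)%E.
  have := mid x (- x); rewrite subrr scaler0 even => /le_trans; apply.
  by rewrite -ge0_muleDl ?lee_fin ?invr_ge0// -EFinD half2 mul1e.
have phi00 : phi t 0 = 0%E.
  apply/eqP; rewrite eq_le phi0 andbT leNgt; apply/negP => pos.
  have /nbhs_ballP[e /= e0 He] :=
    lim0 _ (open_nbhs_nbhs (conj (@open_ereal_lt_ereal _ (phi t 0%R)) pos)).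
  have nx0 : 0 < `|x0| by rewrite normr_gt0.
  (* A nonzero vector of norm [e / 2], hence inside the ball where [phi t] would be below
     [phi t 0]. *)
  pose y := (e / 2 / `|x0|) *: x0.
  have y0 : y != 0.
    by rewrite scaler_eq0 negb_or x00 andbT !mulf_neq0 ?invr_neq0 ?gt_eqF.
  have := He y; rewrite /= -ball_normE /= sub0r normrN.
  rewrite normrZ ger0_norm ?divr_ge0 ?ltW// divfK ?gt_eqF//.
  have ee : e / 2 < e by rewrite ltr_pdivrMr// ltr_pMr// ltr1n.
  by move=> /(_ ee y0) /=; rewrite ltNge phi0le.
split=> // a x a01.
have := conv x 0 a a01; rewrite scaler0 addr0 phi00 mule0 adde0 => /le_trans; apply.
have /andP[a0 a1] := a01.
by rewrite -[leRHS]mul1e; apply: lee_wpmul2r => //; rewrite lee_fin.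
Qed.

Lemma lux_norm_ge0 u : (0 <= lux_norm mu phi u)%E.
Proof. by apply: le_ereal_inf_tmp => _ [a [a0 _] <-]; rewrite lee_fin ltW. Qed.

Lemma lux_norm_le u e : 0 < e -> (\int[mu]_t phi t (e^-1 *: u t) <= 1)%E ->
  (lux_norm mu phi u <= e%:E)%E.
Proof. by move=> e0 ue; apply: ereal_inf_lbound; exists e. Qed.

(** In the zero space the modular depends neither on the function nor on the scaling, so one
    admissible scaling makes every scaling admissible. *)
Lemma lux_norm_trivial (u v : T -> X) : (forall x : X, x = 0) ->
  (lux_norm mu phi u < +oo)%E -> lux_norm mu phi v = 0%E.
Proof.
move=> X0 /ereal_inf_lt[_ [a [a0 ua] <-] _].
apply/eqP; rewrite eq_le lux_norm_ge0 andbT; apply/lee_addgt0Pr => e e0.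
rewrite add0e; apply: lux_norm_le => //; apply: le_trans ua.
rewrite le_eqVlt; apply/orP; left; apply/eqP; congr integral; apply/funext => t.
by rewrite (X0 (_ *: v t)) (X0 (_ *: u t)).
Qed.

(** * Modular estimates off a fixed exceptional null set [Z] *)

Variable Z : set T.
Hypothesis negZ : mu.-negligible Z.
Hypothesis regZ : forall t, ~ Z t ->
    [/\ phi t 0 = 0%E, forall x, phi t (- x) = phi t x,
        forall x y, (phi t (2^-1 *: (x + y)) <=
                     2^-1%:E * phi t x + 2^-1%:E * phi t y)%E &
        forall (a : R) x, 0 <= a <= 1 -> (phi t (a *: x) <= phi t x)%E].

Lemma phi_scale t x (a b : R) : ~ Z t -> 0 < a -> a <= b ->
  (phi t (b^-1 *: x) <= phi t (a^-1 *: x))%E.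
Proof.
move=> /regZ[_ _ _ scal] a0 ab; have b0 := lt_le_trans a0 ab.
have -> : b^-1 *: x = (a / b) *: (a^-1 *: x).
  by rewrite scalerA mulrAC divff ?mul1r ?gt_eqF.
apply: scal; apply/andP; split; first by rewrite divr_ge0 ?ltW.
by rewrite ler_pdivrMr// mul1r.
Qed.

(** The strict inequality provides an admissible scaling below [e], and enlarging the scaling
    decreases the modular. *)
Lemma lux_norm_lt u e D : (lux_norm mu phi u < e%:E)%E ->
  (\int[mu]_(t in D) phi t (e^-1 *: u t) <= 1)%E.
Proof.
move=> /ereal_inf_lt[_ [a [a0 ua] <-]]; rewrite lte_fin => ae.
apply: le_trans ua; apply: (@le_lower_integral _ _ _ _ _ _ _ _ Z) => // t _ Zt.
by split=> //; apply: phi_scale => //; exact: ltW.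
Qed.

(** This replaces the triangle inequality. Additivity of the integral requires measurable
    integrands, available on the sigma-finite set [S] after removal of the null sets [N1] and
    [N2]. *)
Lemma integral_midpoint_le u v S : sigma_finite_set mu S -> measurable S ->
  strongly_measurable mu u -> strongly_measurable mu v ->
  (\int[mu]_(t in S) phi t (u t) <= 1)%E ->
  (\int[mu]_(t in S) phi t (v t) <= 1)%E ->
  (\int[mu]_(t in S) phi t (2^-1 *: (u t + v t)) <= 1)%E.
Proof.
move=> sS mS su sv u1 v1.
have [N1 [mN1 N10 mu1]] := measurable_superposition phiP sS mS su.
have [N2 [mN2 N20 mu2]] := measurable_superposition phiP sS mS sv.
pose S' := S `\` (N1 `|` N2).
have mS' : measurable S' by apply: measurableD => //; exact: measurableU.
have m1 : measurable_fun S' (fun t => phi t (u t)).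
  apply: measurable_funS mu1; first exact: measurableD.
  by apply: setDS; exact: subsetUl.
have m2 : measurable_fun S' (fun t => phi t (v t)).
  apply: measurable_funS mu2; first exact: measurableD.
  by apply: setDS; exact: subsetUr.
have sub w : (\int[mu]_(t in S') phi t (w t) <= \int[mu]_(t in S) phi t (w t))%E.
  apply: (@le_lower_integral _ _ _ _ _ _ _ _ set0) => //.
    exact: negligible_set0.
  by move=> t [].
have h0 : (0 <= 2^-1 :> R) by rewrite invr_ge0.
apply: (@le_trans _ _ (\int[mu]_(t in S')
    (2^-1%:E * phi t (u t) + 2^-1%:E * phi t (v t)))%E).
  apply: (@le_lower_integral _ _ _ _ _ _ _ _ (Z `|` (N1 `|` N2))) => //.
  - by move=> t; rewrite adde_ge0// mule_ge0// lee_fin.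
  - apply: negligibleU => //; apply: negligibleU.
      by exists N1; split.
    by exists N2; split.
  - move=> t St /not_orP[Zt nN]; split; first by split.
    by have [_ _ mid _] := regZ Zt; exact: mid.
rewrite ge0_integralD//; last 4 first.
- by move=> t _; rewrite mule_ge0// lee_fin.
- exact: measurable_funeM.
- by move=> t _; rewrite mule_ge0// lee_fin.
- exact: measurable_funeM.
rewrite !ge0_integralZl//.
have le2 w : (\int[mu]_(t in S) phi t (w t) <= 1 ->
    2^-1%:E * \int[mu]_(t in S') phi t (w t) <= 2^-1%:E)%E.
  move=> w1; rewrite -[leRHS]mule1; apply: lee_wpmul2l; first by rewrite lee_fin.
  exact: le_trans (sub w) w1.
apply: le_trans (leeD (le2 _ u1) (le2 _ v1)) _.
by rewrite -EFinD [X in (_ <= X%:E)%E](splitr 1) mul1r.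
Qed.

(* If [w - v j] is small on [S j] for both choices [w = u] and [w = 0], then so
   is [u] by the triangle inequality; hence one of the two choices is far from
   [v j]. *)
Lemma restriction_far_from_sequence u (v : nat -> T -> X) (S : nat -> set T) e :
  0 < e -> strongly_measurable mu u ->
  (forall j, strongly_measurable mu (v j)) ->
  (forall j, measurable (S j)) -> trivIset setT S ->
  (forall j, sigma_finite_set mu (S j)) ->
  (forall j, 1 < \int[mu]_(t in S j) phi t (e^-1 *: u t))%E ->
  exists w, [/\ strongly_measurable mu w, forall t, w t = u t \/ w t = 0 &
    forall j, ~ (lux_norm mu phi (fun t => (w t - v j t)%R) < (e / 2)%:E)%E].
Proof.
move=> e0 su sv mS tS sS Su.
pose K j := (\int[mu]_(t in S j) phi t ((e / 2)^-1 *: v j t) <= 1)%E.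
have s0 : strongly_measurable mu (fun _ : T => 0 : X).
  by move: (strongly_measurableZ 0 su); under eq_fun do rewrite scale0r.
have [|w [sw wS w0]] := @strongly_measurable_glue _ _ _ mu _
    (fun j => if K j then u else (fun=> 0)) S mS tS.
  by move=> j; case: ifP.
exists w; split=> //.
  move=> t; have [[j _ Sj]|nS] := pselect ((\bigcup_j S j) t); last by right; exact: w0.
  by rewrite (wS j)//; case: ifP => _; [left|right].
move=> j /(lux_norm_lt (S j)) wj; case: (boolP (K j)) => Kj.
  have := Su j; rewrite ltNge => /negP; apply.
  have eqw t : S j t -> w t = u t by move=> Sj; rewrite (wS j)// Kj.
  (* The midpoint of [(e / 2)^-1 *: (w t - v j t)] and [(e / 2)^-1 *: v j t] is [e^-1 *: w t],
     whence the distance [e / 2]. *)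
  have := @integral_midpoint_le (fun t => (e / 2)^-1 *: (w t - v j t))
    (fun t => (e / 2)^-1 *: v j t) (S j) (sS j) (mS j)
    (strongly_measurableZ _ (strongly_measurableB sw (sv j)))
    (strongly_measurableZ _ (sv j)) wj Kj.
  apply: le_trans; apply: (@le_lower_integral _ _ _ _ _ _ _ _ set0) => //.
    exact: negligible_set0.
  move=> t St _; split=> //; rewrite -scalerDr subrK scalerA eqw//.
  by rewrite -invfM [2 * _]mulrC divfK.
apply: (negP Kj); apply: le_trans wj.
apply: (@le_lower_integral _ _ _ _ _ _ _ _ Z) => // t St Zt; split=> //.
rewrite (wS j)// (negbTE Kj) sub0r scalerN.
by have [_ -> _ _] := regZ Zt.
Qed.

(* On a purely infinite set the superposition may fail to be measurable and the
   triangle inequality may fail.  One uses instead that either [u + v j] is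
   small on [P j], so that [w = u + v j] is admissible there and [w - v j = u],
   or it is not, and then [w = - u] is far from [v j]. *)
Lemma far_from_sequence_purely_infinite u (v : nat -> T -> X) A
    (P : nat -> set T) e (c : R) :
  0 < e -> 0 < c -> strongly_measurable mu u -> (lux_norm mu phi u < +oo)%E ->
  (forall j, strongly_measurable mu (v j)) ->
  (forall t, A t -> (c%:E <= phi t (e^-1 *: u t))%E) ->
  (forall B, measurable B -> B `<=` A -> mu B = 0%E \/ mu B = +oo%E) ->
  (forall j, measurable (P j)) -> trivIset setT P ->
  (forall j, P j `<=` A) -> (forall j, 0 < mu (P j))%E ->
  exists w, [/\ strongly_measurable mu w, (lux_norm mu phi w < +oo)%E &
    forall j, ~ (lux_norm mu phi (fun t => (w t - v j t)%R) < e%:E)%E].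
Proof.
move=> e0 c0 su /ereal_inf_lt[_ [a [a0 ua] <-] _] sv cA Aoo mP tP PA P0.
pose Q j := (\int[mu]_(t in P j) phi t (e^-1 *: (u t + v j t)) <= 1)%E.
have [|w [sw wP w0]] := @strongly_measurable_glue _ _ _ mu _
    (fun j t => if Q j then u t + v j t else - u t) P mP tP.
  move=> j; case: (Q j); first exact: strongly_measurableD.
  exact: strongly_measurableN.
exists w; split=> //.
  (* The scaling [a] is admissible for [- u] and [e] for [u + v j] on the pieces where [Q j] holds;
     the maximum serves on all pieces at once. *)
  apply: (@le_lt_trans _ _ (Num.max a e)%:E); last by rewrite ltry.
  have m0 : 0 < Num.max a e by rewrite lt_max a0.
  apply: lux_norm_le => //; apply: (@le_trans _ _ 0%E) => //.
  (* Finiteness on each single piece suffices: on a purely infinite set the total modular is then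
     [0]. *)
  apply: (purely_infinite_integral_bigcup Aoo mP PA) negZ _ _ => //.
    by move=> t nP Zt; rewrite w0// scaler0; have [] := regZ Zt.
  move=> j; apply: (@le_lt_trans _ _ 1%E); last by rewrite ltry.
  case: (boolP (Q j)) => Qj.
    apply: le_trans (Qj); apply: (@le_lower_integral _ _ _ _ _ _ _ _ Z) => // t Pt Zt.
    split=> //; rewrite (wP j)// Qj; apply: phi_scale => //.
    by rewrite le_max lexx orbT.
  apply: le_trans ua; apply: (@le_lower_integral _ _ _ _ _ _ _ _ Z) => // t Pt Zt.
  split=> //; rewrite (wP j)// (negbTE Qj) scalerN; have [_ -> _ _] := regZ Zt.
  by apply: phi_scale => //; rewrite le_max lexx.
move=> j /(lux_norm_lt (P j)) wj; case: (boolP (Q j)) => Qj.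
  have Poo : mu (P j) = +oo%E.
    by case: (Aoo _ (mP j) (PA j)) => // Pj0; have := P0 j; rewrite Pj0 ltxx.
  (* Here [w - v j] equals [u] on [P j], so the integrand is at least [c] on a set of infinite
     measure. *)
  suff : (\int[mu]_(t in P j) phi t (e^-1 *: (w t - v j t)) = +oo)%E.
    by move=> woo; rewrite woo in wj.
  apply: (purely_infinite_integral _ (mP j) Poo c0) => // t Pt.
  by rewrite (wP j)// Qj addrK; apply: cA; exact: PA Pt.
apply: (negP Qj); apply: le_trans wj.
apply: (@le_lower_integral _ _ _ _ _ _ _ _ Z) => // t Pt Zt; split=> //.
rewrite (wP j)// (negbTE Qj) -opprD scalerN.
by have [_ -> _ _] := regZ Zt.
Qed.

(** * Absolute continuity of the norm, and its derivation from separability *)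

Lemma Cphi_or_tail u : Lphi mu phi u -> Cphi mu phi u \/
  exists e (F : nat -> set T), [/\ 0 < e, forall n, measurable (F n),
    forall m n, (m <= n)%N -> F n `<=` F m, mu.-negligible (\bigcap_n F n) &
    forall n, (1 < \int[mu]_(t in F n) phi t (e^-1 *: u t))%E].
Proof.
move=> Lu; apply: contrapT => /not_orP[nC notail]; apply: nC; split=> // E mE E0.
(* The intersection of the [F n] is the upper limit of the [E k], a null set because the indicators
   tend to [0]. A modular at most [1] on some [F n] bounds the norms for all [E k] with [k >= n]. *)
pose F n := \bigcup_(k in [set k | (n <= k)%N]) E k.
have mF n : measurable (F n) by apply: bigcup_measurable.
have decF m n : (m <= n)%N -> F n `<=` F m.
  by move=> mn t [k /= nk Ek]; exists k => //=; exact: leq_trans nk.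
have F0 : mu.-negligible (\bigcap_n F n).
  apply: negligibleS E0 => t Ft /= E0.
  have [n _ En] := cvgr_lt _ E0 1 ltr01.
  have [k /= nk Ek] := Ft n I.
  by have := En k nk; rewrite /= indicE mem_set// ltxx.
have lux e : 0 < e -> \forall n \near \oo,
    (lux_norm mu phi (fun t => (\1_(E n) t : R) *: u t) <= e%:E)%E.
  move=> e0; have [n un] : exists n,
      (\int[mu]_(t in F n) phi t (e^-1 *: u t) <= 1)%E.
    apply: contrapT => nn; apply: notail; exists e, F; split=> // n.
    by rewrite ltNge; apply/negP => un; apply: nn; exists n.
  exists n => // k /= nk; apply: lux_norm_le => //; apply: le_trans un.
  rewrite (integral_mkcond (F n)).
  apply: (@ge0_ae_le_lower_integral _ _ _ _ _ _ Z) => //.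
    by move=> t; apply: erestrict_ge0.
  move=> t Zt; rewrite indicE; case: (boolP (t \in E k)) => [|_].
    rewrite inE => Ek; rewrite scale1r /patch mem_set//.
    by exists k.
  rewrite scale0r scaler0; have [-> _ _ _] := regZ Zt.
  by apply: erestrict_ge0.
have fin e n : (lux_norm mu phi (fun t => (\1_(E n) t : R) *: u t) <= e%:E)%E ->
    lux_norm mu phi (fun t => (\1_(E n) t : R) *: u t) \is a fin_num.
  by move=> le; rewrite ge0_fin_numE ?lux_norm_ge0// (le_lt_trans le)// ltry.
apply/fine_cvgP; split.
  by apply: filterS (lux _ ltr01) => n; exact: fin.
apply/cvgrPdist_le => e e0; apply: filterS (lux _ e0) => n le.
rewrite /= sub0r normrN ger0_norm ?fine_ge0 ?lux_norm_ge0//.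
by rewrite -lee_fin fineK//; exact: fin le.
Qed.

Lemma Lphi_restriction u w : Lphi mu phi u -> strongly_measurable mu w ->
  (forall t, w t = u t \/ w t = 0) -> Lphi mu phi w.
Proof.
move=> [_ /ereal_inf_lt[_ [a [a0 ua] <-] _]] sw wu; split=> //.
apply: (@le_lt_trans _ _ a%:E); last by rewrite ltry.
apply: lux_norm_le => //; apply: le_trans ua.
apply: (@ge0_ae_le_lower_integral _ _ _ _ _ _ Z) => // t Zt.
by case: (wu t) => -> //; rewrite scaler0; have [-> _ _ _] := regZ Zt.
Qed.

Lemma lux_separable_sequence (L : set (T -> X)) u :
  lux_separable mu phi L -> L u ->
  exists v : nat -> T -> X, (forall j, L (v j)) /\
    forall w e, L w -> 0 < e ->
      exists j, (lux_norm mu phi (fun t => (w t - v j t)%R) < e%:E)%E.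
Proof.
move=> [D [/countable_injP[f injf] DL dense]] Lu.
(* The dense set is enumerated through the injection [f]; indices that [f] does not reach receive
   the default value [u], so an empty or finite set causes no trouble. *)
have /choice[v Hv] : forall j, exists x, L x /\ forall y, D y -> f y = j -> x = y.
  move=> j; have [[x [Dx xj]]|nD] := pselect (exists x, D x /\ f x = j).
    exists x; split; first exact: DL.
    by move=> y Dy yj; apply: injf; rewrite ?inE// xj.
  by exists u; split=> // y Dy yj; case: nD; exists y.
exists v; split=> [j|w e Lw e0]; first exact: (Hv j).1.
have [x Dx wx] := dense w Lw e e0.
by exists (f x); rewrite ((Hv (f x)).2 x).
Qed.

(** Common core of both assertions. Stability under restriction keeps the far function [w] inside
    [L], and the last hypothesis on [L] supplies the sigma-finite sets on which [w] is built. *)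
Lemma lux_separable_sub_Cphi (L : set (T -> X)) :
  L `<=` Lphi mu phi -> lux_separable mu phi L ->
  (forall u w, L u -> strongly_measurable mu w ->
     (forall t, w t = u t \/ w t = 0) -> L w) ->
  (forall u e D, L u -> 0 < e -> measurable D ->
     (1 < \int[mu]_(t in D) phi t (e^-1 *: u t))%E ->
     exists S, [/\ measurable S, S `<=` D, sigma_finite_set mu S &
       (1 < \int[mu]_(t in S) phi t (e^-1 *: u t))%E]) ->
  L `<=` Cphi mu phi.
Proof.
move=> LLphi sepL restrL sigmaL u Lu.
have [//|[e [F [e0 mF decF F0 uF]]]] := Cphi_or_tail (LLphi _ Lu).
have [S [mS tS sS uS]] := disjoint_sigma_finite_pieces (fun t => phi0 t (e^-1 *: u t))
  mF decF F0 uF (fun D => @sigmaL u e D Lu e0).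
have [v [Lv dense]] := lux_separable_sequence sepL Lu.
have [w [sw wu far]] := restriction_far_from_sequence e0 (LLphi _ Lu).1
  (fun j => (LLphi _ (Lv j)).1) mS tS sS uS.
have e20 : 0 < e / 2 by rewrite divr_gt0.
by have [j /far] := dense w _ (restrL u w Lu sw wu) e20.
Qed.

(** If no sigma-finite reduction exists, a purely infinite set appears; it splits into infinitely
    many pieces, and the diagonal function on them contradicts density. *)
Lemma Lphi_separable_sub_Cphi :
  lux_separable mu phi (Lphi mu phi) ->
  (forall A, atom mu A -> (mu A < +oo)%E) -> Lphi mu phi `<=` Cphi mu phi.
Proof.
move=> sepL noatom; apply: lux_separable_sub_Cphi => //; first exact: Lphi_restriction.
move=> u e D Lu e0 mD uD.
have [//|[A [c [c0 [mA AD] A0 cA Aoo]]]] := sigma_finite_or_purely_infinite ler01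
  (fun t => phi0 t (e^-1 *: u t)) mD uD.
have [P [mP PA P0 tP]] := purely_infinite_split mA A0 Aoo noatom.
have [v [Lv dense]] := lux_separable_sequence sepL Lu.
have [w [sw wfin far]] := far_from_sequence_purely_infinite e0 c0 Lu.1 Lu.2
  (fun j => (Lv j).1) cA Aoo mP tP PA P0.
by have [j /far] := dense w e (conj sw wfin) e0.
Qed.

(** The sigma-finite reduction of [D] is its intersection with a sigma-finite set carrying [u]:
    elsewhere the integrand is [phi t 0 = 0] almost everywhere. *)
Lemma Lphi_sigma_separable_sub_Cphi :
  lux_separable mu phi (Lphi_sigma mu phi) ->
  Lphi_sigma mu phi `<=` Cphi mu phi.
Proof.
move=> sepL; apply: lux_separable_sub_Cphi => //; first by move=> u [].
  move=> u w [Lu [S [sS uS]]] sw wu; split; first exact: Lphi_restriction wu.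
  exists S; split=> //; apply: filterS uS => t ut St.
  by case: (wu t) => -> //; exact: ut.
move=> u e D [_ [S [sS uS]]] e0 mD uD.
exists (D `&` S); split.
- by apply: measurableI => //; exact: sigma_finite_set_measurable sS.
- exact: subIsetl.
- exact: sigma_finite_setIl.
apply: lt_le_trans uD _; rewrite (integral_mkcond D) (integral_mkcond (D `&` S)).
apply: (@ge0_ae_le_lower_integral _ _ _ _ _ _ _ _ _ (negligibleU negZ uS)).
- by move=> t; apply: erestrict_ge0.
- by move=> t; apply: erestrict_ge0.
move=> t /not_orP[Zt /contrapT /= ut]; rewrite /patch.
case: ifPn => [Dt|_]; last by case: ifPn.
case: ifPn => // nDS; rewrite ut ?scaler0; first by have [-> _ _ _] := regZ Zt.
by move=> St; move: nDS; rewrite in_setI Dt mem_set.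
Qed.

End orlicz.

Unset Implicit Arguments.

Theorem theorem3p4p12 (d : measure_display) (T : measurableType d) (R : realType)
  (mu : {measure set T -> \bar R}) (X : completeNormedModType R)
  (phi : T -> X -> \bar R) :
  (0 < mu setT)%E ->
  orlicz_integrand mu phi ->
  ((lux_separable mu phi (Lphi mu phi) ->
    (forall A, atom mu A -> (mu A < +oo)%E) ->
    Lphi mu phi = Cphi mu phi) /\
   (lux_separable mu phi (Lphi_sigma mu phi) ->
    Lphi_sigma mu phi = Cphi_sigma mu phi)).
Proof.
(* The zero space is treated apart: punctured neighbourhoods of [0] are empty there, so [phi t 0]
   may be positive, but every element of [Lphi] has norm [0]. *)
move=> _ phiP; have [X0|/existsNP[x0 /eqP x0n0]] := pselect (forall x : X, x = 0).
  have LC : Lphi mu phi = Cphi mu phi.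
    apply/seteqP; split=> u; last by case.
    move=> Lu; split=> // E _ _; apply: cvg_near_cst; apply: nearW => n.
    exact: lux_norm_trivial X0 Lu.2.
  by split=> // _; rewrite /Lphi_sigma LC.
have [Z negZ regZ] := orlicz_integrand_regular phiP x0n0.
split=> [sepL noatom|sepL]; apply/seteqP; split=> u.
- exact: Lphi_separable_sub_Cphi regZ sepL noatom u.
- by case.
- move=> Lu; split; last exact: Lu.2.
  exact: Lphi_sigma_separable_sub_Cphi regZ sepL u Lu.
- by case=> -[Lu _] su; split.
Qed.
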